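(* Let $G=(V\cup\{s\},E)$ be a finite, connected, undirected, loop-free graph (multiple edges allowed) with sink $s\notin V$, $p\in(0,1)$, and let $e=\{a,b\}\in E$ be an edge which is not a bridge and not incident to $s$; let $k\ge1$ be the multiplicity of $\{a,b\}$ in $G$. Define $f$ on ${\sf Sto}(G)$ by: if $\eta\in{\sf Sto}_{(A)}(G)$, then $f(\eta)=\eta-\mathbbm{1}_a$, a configuration on $G\setminus e$ (so $l^{G\setminus e}_{f(\eta)}(a)=l^G_\eta(a)$, $l^{G\setminus e}_{f(\eta)}(b)=l^G_\eta(b)-1$, and other lacking numbers unchanged); if $\eta\in{\sf Sto}_{(B)}(G)$, then $f(\eta)$ is the configuration on $G.e$ with $f(\eta)_v=\eta_v$ for $v\ne a.b$ and $l^{G.e}_{f(\eta)}(a.b)=l^G_\eta(a)+l^G_\eta(b)$ (i.e. $f(\eta)_{a.b}=\eta_a+\eta_b-k-1$). Then $f$ is a bijection from ${\sf Sto}(G)$ onto ${\sf Sto}(G\setminus e)\cup{\sf Sto}(G.e)$.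
   Context: $\mathbbm{1}_a$ is the indicator vector of $a$. $G\setminus e$ is $G$ with one copy of $e$ removed. $G.e$: if $k=1$, contract $e$, merging $a,b$ into a vertex $a.b$ carrying all other edges of $a$ and $b$; if $k\ge2$, contract one copy and replace the other $k-1$ copies by $k-1$ edges $\{a.b,s\}$. For such a graph $H=(W\cup\{s\},F)$: $d^H(v)$ is degree with multiplicity; configurations $\eta\in\mathbb{Z}_{\ge0}^W$ are stable if $\eta_v\le d^H(v)$; $l^H_\eta(v)=d^H(v)-\eta_v$ is the lacking number. In the stochastic sandpile model with parameter $p$, a legal stochastic toppling at $x\in W$ (allowed when $\eta_x>d^H(x)$) chooses independently for each edge at $x$ a Bernoulli($p$) variable, removes the number of successes from $x$ and sends one grain along each successful edge to its other endpoint (discarded if it is $s$). The Markov chain on stable configurations adds a grain at a random vertex of $W$ (distribution with support $W$) then topples until stable; ${\sf Sto}(H)$ is its recurrent class containing $\eta^{\max}=(d^H(v))_{v\in W}$. An orientation orients every edge (parallel edges independently); ${\sf in}_O(v)$ is the in-degree; $\eta$ is compatible with $O$ if ${\sf in}_O(v)\ge1+l_\eta(v)$ for all non-sink $v$. ${\sf Sto}_{(A)}(G)$ is the set of $\eta\in{\sf Sto}(G)$ such that $l^G_\eta(b)>0$ and there exists an orientation $O$ of $G$ compatible with $\eta$ in which some edge between $a$ and $b$ is oriented $a\to b$; ${\sf Sto}_{(B)}(G)={\sf Sto}(G)\setminus{\sf Sto}_{(A)}(G)$. *)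

(* Defs.v *)
From HB Require Import structures.
From mathcomp Require Import all_boot all_order all_algebra.
From mathcomp Require Import all_classical all_reals all_analysis.
Import Order.TTheory GRing.Theory Num.Theory.
Import numFieldNormedType.Exports.

Set Implicit Arguments.
Unset Strict Implicit.
Unset Printing Implicit Defensive.

Local Open Scope classical_set_scope.
Local Open Scope ring_scope.

(* Multigraphs with a sink: edges form a type of their own, so parallel edges
   are distinct objects.  The non-sink vertices are [Some v]; [None] is the
   sink.  The two ends of an edge are listed in an arbitrary order. *)
Record sgraph := SGraph {
  vertex : finType;
  edge : finType;
  ends : edge -> option vertex * option vertex }.

Section Graph.
Variable H : sgraph.

Definition incident (i : edge H) (y : option (vertex H)) : bool :=
  (y == (ends i).1) || (y == (ends i).2).

Definition joins (i : edge H) (y z : option (vertex H)) : bool :=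
  (ends i == (y, z)) || (ends i == (z, y)).

(* Meaningful only when [i] is incident to [y]. *)
Definition other_end (i : edge H) (y : option (vertex H)) : option (vertex H) :=
  if (ends i).1 == y then (ends i).2 else (ends i).1.

Definition loop_free : Prop := forall i : edge H, (ends i).1 != (ends i).2.

Definition adjacent : rel (option (vertex H)) :=
  fun y z => [exists i : edge H, joins i y z].

Definition graph_connected : Prop :=
  forall y z : option (vertex H), connect adjacent y z.

Definition multiplicity (y z : option (vertex H)) : nat :=
  #|[pred i : edge H | joins i y z]|.

Definition deg (v : vertex H) : nat :=
  #|[pred i : edge H | incident i (Some v)]|.

Definition config : Type := {ffun vertex H -> nat}.

Definition unstable (eta : config) (x : vertex H) : bool := (deg x < eta x)%N.

Definition stable (eta : config) : bool := [forall v, (eta v <= deg v)%N].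

Definition eta_max : config := [ffun v => deg v].

(* Integer-valued, so that no truncation occurs. *)
Definition lack (eta : config) (v : vertex H) : int :=
  (deg v)%:Z - (eta v)%:Z.

Definition orientation : Type := edge H -> bool.

Definition head_of (O : orientation) (i : edge H) : option (vertex H) :=
  if O i then (ends i).2 else (ends i).1.

Definition tail_of (O : orientation) (i : edge H) : option (vertex H) :=
  if O i then (ends i).1 else (ends i).2.

Definition indeg (O : orientation) (v : vertex H) : nat :=
  #|[pred i : edge H | head_of O i == Some v]|.

Definition compatible (eta : config) (O : orientation) : Prop :=
  forall v : vertex H, 1 + lack eta v <= (indeg O v)%:Z.

Definition add_grain (eta : config) (v : vertex H) : config :=
  [ffun w => (eta w + (w == v))%N].

(* [S] is the set of successful edges at [x]. *)
Definition topple (eta : config) (x : vertex H) (S : {set edge H}) : config :=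
  [ffun v => (eta v - (if v == x then #|S| else 0)
              + #|[pred i in S | other_end i (Some x) == Some v]|)%N].

(* The data of the chain besides [p]: the law of the vertex receiving a grain,
   and the order of the topplings, an arbitrary rule selecting the unstable
   vertex to be toppled next. *)
Record driving (R : realType) := Driving {
  add_law : vertex H -> R;
  add_law_gt0 : forall v, 0 < add_law v;
  add_law_sum1 : \sum_v add_law v = 1;
  next_site : config -> vertex H;
  next_site_unstable : forall eta, ~~ stable eta -> unstable eta (next_site eta) }.

Section Chain.
Variables (R : realType) (p : R) (D : driving R).

Definition success_prob (x : vertex H) (S : {set edge H}) : R :=
  \prod_(i | incident i (Some x)) (if i \in S then p else 1 - p).

(* Probability that, started from [eta], at most [n] topplings are needed to
   stabilize, and that the stable configuration reached is [xi]. *)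
Fixpoint stab_prob_upto (n : nat) (eta xi : config) : R :=
  if stable eta then (eta == xi)%:R
  else if n is m.+1 then
    \sum_(S : {set edge H}
            | S \subset [pred i : edge H | incident i (Some (next_site D eta))])
      success_prob (next_site D eta) S
      * stab_prob_upto m (topple eta (next_site D eta) S) xi
  else 0.

Definition stab_prob (eta xi : config) : R :=
  limn (fun n => stab_prob_upto n eta xi).

Definition trans_prob (eta xi : config) : R :=
  \sum_v add_law D v * stab_prob (add_grain eta v) xi.

Definition accessible (eta xi : config) : Prop :=
  exists s : seq config,
    path (fun z z' => 0 < trans_prob z z') eta s /\ last eta s = xi.

Definition communicate (eta xi : config) : Prop :=
  accessible eta xi /\ accessible xi eta.

(* Recurrence for a chain with finitely many states (here, the stable
   configurations): every state accessible from [eta] leads back to [eta]. *)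
Definition recurrent (eta : config) : Prop :=
  forall xi, accessible eta xi -> accessible xi eta.

Definition Sto : set config :=
  [set eta | [/\ stable eta, recurrent eta & communicate eta_max eta]].

Definition StoA (a b : vertex H) : set config :=
  [set eta | [/\ Sto eta, 0 < lack eta b
    & exists O : orientation, compatible eta O /\
        exists i : edge H, tail_of O i = Some a /\ head_of O i = Some b]].

Definition StoB (a b : vertex H) : set config := Sto `\` StoA a b.

End Chain.
End Graph.

Definition delete_edge (G : sgraph) (e : edge G) : sgraph :=
  @SGraph (vertex G) {i : edge G | i != e} (fun i => ends (val i)).

Definition bridge (G : sgraph) (e : edge G) : Prop :=
  ~ graph_connected (delete_edge e).

Section Contract.
Variables (G : sgraph) (e : edge G) (a b : vertex G).

(* [None] is the merged vertex a.b. *)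
Definition contract_vertex : finType :=
  option {v : vertex G | (v != a) && (v != b)}.

(* [insub] sends [a] and [b] to the merged vertex, and fixes the others. *)
Definition contract_proj (y : option (vertex G)) : option contract_vertex :=
  omap insub y.

Definition contract_ends (i : {i : edge G | i != e}) :
    option contract_vertex * option contract_vertex :=
  if joins (val i) (Some a) (Some b) then (Some None, None)
  else (contract_proj (ends (val i)).1, contract_proj (ends (val i)).2).

(* Meaningful only when [e] joins [a] and [b]. *)
Definition contract_edge : sgraph :=
  @SGraph contract_vertex {i : edge G | i != e} contract_ends.

Definition merged : vertex contract_edge := None.

Section Map.
Variables (R : realType) (p : R) (D : driving G R).

Definition sto_mapA (eta : config G) : config (delete_edge e) :=
  [ffun v => (eta v - (v == a))%N].

Definition sto_mapB (eta : config G) : config contract_edge :=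
  [ffun w : contract_vertex => if w is Some v then eta (val v)
    else (eta a + eta b - (multiplicity (Some a) (Some b)).+1)%N].

(* Configurations on [G \ e] and on [G.e] live in different types, hence the
   sum.  That the truncated subtractions in [sto_mapA] and [sto_mapB] are
   exact on the relevant sets is expressed with the integer-valued [lack]. *)
Definition sto_map (eta : config G) : config (delete_edge e) + config contract_edge :=
  if `[< StoA p D a b eta >] then inl (sto_mapA eta) else inr (sto_mapB eta).

End Map.
End Contract.

(* Main.v *)
(* A configuration is recurrent iff it is stable and compatible with some
   orientation.  Compatibility is preserved by topplings (orient the successful
   edges into the toppled vertex) and holds for eta_max.  Conversely a
   compatible configuration is reached from eta_max by toppling along edges
   prescribed by the orientation and by flushing excess grains to the sink
   along shortest paths.

   The set A is in bijection with Sto(G\e) by deleting an edge oriented from a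
   to b.  Contraction maps Sto(G) onto Sto(G.e), the fibres being sets of
   configurations which differ by moving grains between a and b; by Hall's
   theorem, exactly one element of each fibre, the one with most grains at b,
   lies outside A. *)
Require Import Defs.
From HB Require Import structures.
From mathcomp Require Import all_boot all_order all_algebra.
From mathcomp Require Import all_classical all_reals all_analysis.
From mathcomp Require Import zify.
Import Order.TTheory GRing.Theory Num.Theory.
Import numFieldNormedType.Exports.

Set Implicit Arguments.
Unset Strict Implicit.
Unset Printing Implicit Defensive.

(** * Orientations, out-degrees and a Hall-type existence criterion *)

Section Orientation.
Variable H : sgraph.
Implicit Types (O : orientation H) (v : vertex H) (i : edge H) (A B : {set vertex H}).

Definition outdeg O v : nat := \sum_i (tail_of O i == Some v).

Lemma degE v : deg v = \sum_i incident i (Some v).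
Proof. by rewrite /deg -sum1_card big_mkcond; apply: eq_bigr => i _; rewrite inE; case: (X in if X then _ else _). Qed.

Lemma indegE O v : indeg O v = \sum_i (head_of O i == Some v).
Proof. by rewrite /indeg -sum1_card big_mkcond; apply: eq_bigr => i _; rewrite inE; case: (X in if X then _ else _). Qed.

Lemma tail_or_head O i y : loop_free H ->
  ((tail_of O i == y) + (head_of O i == y) = incident i y)%N.
Proof.
move=> /(_ i); rewrite /tail_of /head_of /incident !(eq_sym y).
case: (ends i) => u w /= uw; case: (O i).
all: case: (u =P y) => [uy|_]; case: (w =P y) => [wy|_] //.
all: by rewrite uy wy eqxx in uw.
Qed.

Lemma outdeg_indeg O v : loop_free H -> (outdeg O v + indeg O v = deg v)%N.
Proof.
move=> lf; rewrite indegE degE -big_split; apply: eq_bigr => i _.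
exact: tail_or_head.
Qed.

Lemma compatibleE (eta : config H) O : loop_free H ->
  compatible eta O <-> forall v, (outdeg O v < eta v)%N.
Proof.
move=> lf; split=> h v; move: (h v) (outdeg_indeg O v lf); rewrite /lack; lia.
Qed.

(** The sink lies outside every set, so an edge at the sink is never inner: it can always be given
    to the sink, whose load is unrestricted. *)
Definition in_ext A (y : option (vertex H)) : bool := if y is Some v then v \in A else false.

Definition inner_edge A i : bool := in_ext A (ends i).1 && in_ext A (ends i).2.

(** Together with the modularity in [sum_setUI], this lets two tight sets be uncrossed in
    [hall_orientation]. *)
Lemma inner_edge_supermod A B i :
  (inner_edge A i + inner_edge B i
     <= inner_edge (A :|: B) i + inner_edge (A :&: B) i)%N.
Proof.
rewrite /inner_edge; case: (ends i) => [[y|] [z|]] //=; rewrite ?andbF //.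
by rewrite !inE; case: (y \in A); case: (y \in B); case: (z \in A); case: (z \in B).
Qed.

Lemma sum_setUI A B (c : vertex H -> nat) :
  (\sum_(v in A :|: B) c v + \sum_(v in A :&: B) c v
     = \sum_(v in A) c v + \sum_(v in B) c v)%N.
Proof.
rewrite (big_mkcond (mem (A :|: B))) (big_mkcond (mem (A :&: B))).
rewrite (big_mkcond (mem A)) (big_mkcond (mem B)) /= -!big_split.
apply: eq_bigr => v _; rewrite !inE.
by case: (v \in A); case: (v \in B); rewrite /= ?addn0.
Qed.

(* Hall's condition, for the assignment of each edge to one of its ends: an
   edge that can be given to neither end without violating the condition
   produces two tight sets whose union violates it. *)
Lemma hall_orientation (c : vertex H -> nat) (F : {set edge H}) :
  (forall A, (\sum_(i in F) inner_edge A i <= \sum_(v in A) c v)%N) ->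
  exists O, forall v, (\sum_(i in F) (tail_of O i == Some v) <= c v)%N.
Proof.
have [n] := ubnP #|F|; elim: n F c => // n IH F c.
have [->|[i iF]] := set_0Vmem F.
  by move=> _ _; exists (fun=> true) => v; rewrite big_set0.
rewrite ltnS (cardsD1 i) iF add1n => ltF hF.
have inner_D1 A : (\sum_(j in F) inner_edge A j
    = inner_edge A i + \sum_(j in F :\ i) inner_edge A j)%N by rewrite (big_setD1 i).
have step (w : bool) : (forall A, (\sum_(j in F :\ i) inner_edge A j
      + in_ext A (if w then (ends i).1 else (ends i).2) <= \sum_(v in A) c v)%N) ->
    exists O, forall v, (\sum_(j in F) (tail_of O j == Some v) <= c v)%N.
  set y := if w then _ else _ => hw.
  (* The singleton of the chosen end shows that its capacity is positive, so the truncated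
     subtraction in the capacity passed to [IH] is exact. *)
  have c_gt0 v : y = Some v -> (0 < c v)%N.
    by move=> yE; move: (hw [set v]); rewrite big_set1 yE /= inE eqxx; lia.
  have [A|O hO] := IH (F :\ i) (fun v => c v - (y == Some v))%N ltF.
    have /= hA := hw A; rewrite -(leq_add2r (in_ext A y)).
    apply: leq_trans hA _; rewrite leq_eqVlt; apply/orP; left; apply/eqP.
    have -> : (in_ext A y : nat) = \sum_(v in A) (y == Some v).
      case: (y) => [u|] /=; last by rewrite big1.
      have [uA|uA] := boolP (u \in A).
        rewrite (bigD1 u) //= eqxx big1 ?addn0 // => v /andP[_ vu].
        by rewrite (inj_eq Some_inj) eq_sym (negPf vu).
      rewrite big1 // => v vA; case: eqP => // -[uv]; by rewrite uv vA in uA.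
    rewrite -big_split; apply: eq_bigr => v vA.
    by case: eqP => [/c_gt0|_] /=; lia.
  exists (fun j => if j == i then w else O j) => v.
  rewrite (big_setD1 i) //= {1}/tail_of eqxx -/y.
  rewrite (eq_bigr (fun j => (tail_of O j == Some v) : nat)); last first.
    by move=> j; rewrite !inE /tail_of => /andP[/negPf ->].
  by have := hO v; case: eqP => [/c_gt0|] /=; lia.
have [/(@step true)//|/existsNP[A hA]] := pselect (forall A, (\sum_(j in F :\ i) inner_edge A j
      + in_ext A (ends i).1 <= \sum_(v in A) c v)%N).
have [/(@step false)//|/existsNP[B hB]] := pselect (forall A, (\sum_(j in F :\ i) inner_edge A j
      + in_ext A (ends i).2 <= \sum_(v in A) c v)%N).
exfalso; have := hF (A :|: B); have := hF (A :&: B).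
have := hF A; have := hF B; have := sum_setUI A B c.
have : (\sum_(j in F :\ i) inner_edge A j + \sum_(j in F :\ i) inner_edge B j
    <= \sum_(j in F :\ i) inner_edge (A :|: B) j
       + \sum_(j in F :\ i) inner_edge (A :&: B) j)%N.
  by rewrite -!big_split leq_sum // => j _; exact: inner_edge_supermod.
move: hA hB; rewrite !inner_D1 /inner_edge.
(* Giving [i] to the sink uses up no capacity, so a failure there contradicts [hF] at once.
   Otherwise [A] contains only the first end and [B] only the second, so [i] is inner to the union
   but to neither set. *)
case: (ends i) => [[y|] [z|]] //=; rewrite ?andbF ?andFb; try lia.
rewrite !inE; case: (y \in A); case: (y \in B); case: (z \in A); case: (z \in B) => /=; lia.
Qed.

(** Each edge inside [A] has its tail in [A]. This is the necessary half of Hall's condition. *)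
Lemma inner_edge_outdeg O A :
  (\sum_i inner_edge A i <= \sum_(v in A) outdeg O v)%N.
Proof.
rewrite /outdeg exchange_big leq_sum //= => i _.
rewrite /inner_edge; case: andP => // -[h1 h2].
have : in_ext A (tail_of O i) by rewrite /tail_of; case: ifP.
case: (tail_of O i) => //= u uA.
by rewrite (bigD1 u) //= eqxx.
Qed.

Definition flip O i : orientation H := fun j => if j == i then ~~ O j else O j.

Lemma tail_flip O i : tail_of (flip O i) i = head_of O i.
Proof. by rewrite /tail_of /head_of /flip eqxx; case: (O i). Qed.

Lemma tail_flip_neq O i j : j != i -> tail_of (flip O i) j = tail_of O j.
Proof. by rewrite /tail_of /flip => /negPf ->. Qed.

Lemma outdeg_flip O i v : (outdeg (flip O i) v + (tail_of O i == Some v)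
   = outdeg O v + (head_of O i == Some v))%N.
Proof.
rewrite /outdeg (bigD1 i) //= (bigD1 i (P := predT)) //= tail_flip.
rewrite (eq_bigr (fun j => (tail_of O j == Some v) : nat)); first lia.
by move=> j ji; rewrite tail_flip_neq.
Qed.

(* Stable configurations compatible with some orientation; counting the
   edges leaving a vertex instead of those entering it eliminates the
   degrees from the compatibility condition. *)
Definition orientable (eta : config H) : Prop :=
  stable eta /\ exists O, forall v, (outdeg O v < eta v)%N.

End Orientation.

(** * From positive probabilities to reachability by topplings *)

Section Chain.
Variables (R : realType) (p : R) (H : sgraph) (D : driving H R).
Hypotheses (hp0 : (0 < p)%R) (hp1 : (p < 1)%R).
Local Open Scope ring_scope.
Implicit Types (eta xi : config H) (S : {set edge H}) (x v : vertex H).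

Definition edges_at x : pred (edge H) := [pred i | incident i (Some x)].

Lemma success_prob_gt0 x S : 0 < success_prob p x S.
Proof. by apply: prodr_gt0 => i _; case: ifP; rewrite ?subr_gt0. Qed.

Lemma success_prob_sum1 x :
  \sum_(S : {set edge H} | S \subset edges_at x) success_prob p x S = 1.
Proof.
(* The total is the expansion of a product of factors p + (1 - p). Off [x] the factor is 0 + 1,
   which cancels every set not contained in [edges_at x]. *)
pose f i := if incident i (Some x) then p else 0.
pose g i := if incident i (Some x) then 1 - p else 1.
have -> : 1 = \prod_i (f i + g i).
  by rewrite big1 // => i _; rewrite /f /g; case: ifP; rewrite ?add0r // addrC subrK.
rewrite bigA_distr [RHS](bigID (fun S : {set edge H} => S \subset edges_at x)) /=.
rewrite [X in _ = _ + X]big1 ?addr0 => [|S /fintype.subsetPn[i iS ni]]; last first.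
  by rewrite (bigD1 i) //= iS /f; move: ni; rewrite inE => /negPf ->; rewrite mul0r.
apply: eq_bigr => S /fintype.subsetP SS; rewrite /success_prob big_mkcond /=.
apply: eq_bigr => i _; rewrite /f /g; case: ifP; case: ifP => // iS ni.
by have := SS i iS; rewrite inE ni.
Qed.

Lemma stab_prob_upto_ge0 n eta xi : 0 <= stab_prob_upto p D n eta xi.
Proof.
elim: n eta => [|n IH] eta /=; case: ifP => // _; apply: sumr_ge0 => S _.
by rewrite mulr_ge0 // ltW // success_prob_gt0.
Qed.

Lemma stab_prob_upto_le1 n eta xi : stab_prob_upto p D n eta xi <= 1.
Proof.
elim: n eta => [|n IH] eta /=; case: ifP => // _; rewrite ?lern1 ?leq_b1 //.
rewrite -(success_prob_sum1 (next_site D eta)); apply: ler_sum => S _.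
by rewrite ler_piMr // ltW // success_prob_gt0.
Qed.

Lemma stab_prob_upto_nondecreasing eta xi :
  nondecreasing_seq (fun n => stab_prob_upto p D n eta xi).
Proof.
apply/nondecreasing_seqP => n; elim: n eta => [|n IH] eta.
  rewrite {1}/stab_prob_upto; case: ifP => [|_]; last exact: stab_prob_upto_ge0.
  by rewrite /= => ->.
rewrite /= -/(stab_prob_upto p D n.+1); case: ifP => // st; apply: ler_sum => S _.
by rewrite ler_wpM2l ?IH // ltW // success_prob_gt0.
Qed.

Definition stabilizes eta xi : Prop := exists n, 0 < stab_prob_upto p D n eta xi.

Lemma stab_prob_upto_le n eta xi : stab_prob_upto p D n eta xi <= stab_prob p D eta xi.
Proof.
apply: nondecreasing_cvgn_le; first exact: stab_prob_upto_nondecreasing.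
apply: nondecreasing_is_cvgn; first exact: stab_prob_upto_nondecreasing.
by exists 1 => _ [m _ <-]; exact: stab_prob_upto_le1.
Qed.

Lemma stab_prob_ge0 eta xi : 0 <= stab_prob p D eta xi.
Proof. exact: le_trans (stab_prob_upto_ge0 0 eta xi) (stab_prob_upto_le 0 eta xi). Qed.

(** The truncated probabilities increase to their limit, which is therefore positive exactly when
    one of them is. From here on only positivity is used. *)
Lemma stab_prob_gt0 eta xi : 0 < stab_prob p D eta xi <-> stabilizes eta xi.
Proof.
split=> [|[n n0]]; last exact: lt_le_trans n0 (stab_prob_upto_le n eta xi).
apply: contraPP => no.
have upto0 : (fun n => stab_prob_upto p D n eta xi) = fun=> 0.
  apply/funext => n; apply/eqP; rewrite eq_le stab_prob_upto_ge0 andbT leNgt.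
  by apply/negP => n0; apply: no; exists n.
by rewrite /stab_prob upto0 lim_cst ?ltxx.
Qed.

Lemma trans_prob_gt0 eta xi :
  0 < trans_prob p D eta xi <-> exists v, stabilizes (add_grain eta v) xi.
Proof.
have term_ge0 v : true -> 0 <= add_law D v * stab_prob p D (add_grain eta v) xi.
  by rewrite mulr_ge0 ?stab_prob_ge0 // ltW // add_law_gt0.
rewrite lt0r; split=> [/andP[/eqP/(psumr_neq0P (fun v => @term_ge0 v)) [v]]|[v h]].
  by rewrite /= pmulr_rgt0 ?add_law_gt0 // => /stab_prob_gt0 h; exists v.
rewrite /trans_prob sumr_ge0 // andbT.
rewrite psumr_neq0 //; apply/hasP; exists v; rewrite ?mem_index_enum //=.
by rewrite mulr_gt0 ?add_law_gt0 //; apply/stab_prob_gt0.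
Qed.

Lemma stabilizes_refl eta : stable eta -> stabilizes eta eta.
Proof. by move=> st; exists 0%N; rewrite /= st eqxx ltr01. Qed.

(** As 0 < p < 1, every set of edges at the toppled vertex occurs with positive probability, so the
    outcome of each toppling may be prescribed. *)
Lemma stabilizes_topple eta xi S :
  ~~ stable eta -> S \subset edges_at (next_site D eta) ->
  stabilizes (topple eta (next_site D eta) S) xi -> stabilizes eta xi.
Proof.
move=> st SS [n n0]; exists n.+1; rewrite /= (negPf st) (bigD1 S) //=.
rewrite ltr_wpDr ?mulr_gt0 ?success_prob_gt0 //; apply: sumr_ge0 => S' _.
by rewrite mulr_ge0 ?stab_prob_upto_ge0 // ltW // success_prob_gt0.
Qed.

(** A positive sum has a positive term, so a positive probability exhibits an actual sequence of
    legal topplings, along which [P] is carried. *)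
Lemma stabilizes_invariant (P : config H -> Prop) :
  (forall eta x S, unstable eta x -> S \subset edges_at x -> P eta -> P (topple eta x S)) ->
  forall eta xi, stabilizes eta xi -> P eta -> stable xi /\ P xi.
Proof.
move=> hP eta xi [n]; elim: n eta => [|n IH] eta /=; case: ifP => //.
- by move=> st; case: eqP => [<-|]; rewrite ?ltxx.
- by rewrite ltxx.
- by move=> st; case: eqP => [<-|]; rewrite ?ltxx.
move=> /negbT st; rewrite lt0r => /andP[/eqP/psumr_neq0P h _] Peta.
case: h => [S _|S /andP[SS]]; first by rewrite mulr_ge0 ?stab_prob_upto_ge0 // ltW // success_prob_gt0.
rewrite pmulr_rgt0 ?success_prob_gt0 // => /IH; apply.
by apply: hP => //; exact: next_site_unstable.
Qed.

Lemma accessible_refl eta : accessible p D eta eta.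
Proof. by exists [::]. Qed.

Lemma accessible_trans eta xi zeta :
  accessible p D eta xi -> accessible p D xi zeta -> accessible p D eta zeta.
Proof.
move=> [s [ps <-]] [t [pt <-]]; exists (s ++ t).
by rewrite cat_path ps pt last_cat.
Qed.

Lemma accessible_step eta v xi :
  stabilizes (add_grain eta v) xi -> accessible p D eta xi.
Proof.
by move=> h; exists [:: xi]; split=> //=; rewrite andbT; apply/trans_prob_gt0; exists v.
Qed.

Lemma accessible_invariant (P : config H -> Prop) :
  (forall eta v, P eta -> P (add_grain eta v)) ->
  (forall eta x S, unstable eta x -> S \subset edges_at x -> P eta -> P (topple eta x S)) ->
  forall eta xi, accessible p D eta xi -> stable eta -> P eta -> stable xi /\ P xi.
Proof.
move=> hadd htop eta xi [s [+ <-]]; elim: s eta => //= zeta s IH eta.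
move=> /andP[/trans_prob_gt0[v hv] ps] _ Peta.
by have [] := stabilizes_invariant htop hv (hadd _ v Peta); exact: IH.
Qed.

End Chain.

(** * Recurrent configurations are the orientable ones *)

Section Recurrent.
Variables (H : sgraph).
Hypotheses (lf : loop_free H) (conn : graph_connected H).
Implicit Types (eta xi : config H) (O : orientation H) (S : {set edge H}).
Implicit Types (T : {set vertex H}) (x v w : vertex H) (i : edge H).

Lemma joins_other_end i y z : joins i y z -> other_end i y = z.
Proof.
rewrite /joins /other_end => /orP[] /eqP -> /=; first by rewrite eqxx.
by case: eqP.
Qed.

Lemma joins_incident i y z : joins i y z -> incident i y.
Proof. by rewrite /joins /incident => /orP[] /eqP -> /=; rewrite eqxx ?orbT. Qed.

(** Take the length of a shortest path to the sink: the second vertex of such a path is strictly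
    closer. *)
Lemma dist_to_sink : exists dist : option (vertex H) -> nat, forall v,
  exists i z, joins i (Some v) z /\ (dist z < dist (Some v))%N.
Proof.
pose to_sink y n := `[< exists s, [/\ path (@Defs.adjacent H) y s, last y s = None & size s = n] >].
have ex_path y : exists n, to_sink y n.
  have /connectP[s ps ls] := conn y None.
  by exists (size s); apply/asboolP; exists s.
exists (fun y => ex_minn (ex_path y)) => v.
case: (ex_minnP (ex_path (Some v))) => n /asboolP[[|z s] [//= + ls <-] _].
move=> /andP[/existsP[i jz] ps]; exists i, z; split=> //.
case: ex_minnP => m _; apply; apply/asboolP; by exists s.
Qed.

(** Orient each edge away from the sink: every vertex then receives an edge from a neighbour closer
    to the sink, so its out-degree is below its degree. *)
Lemma eta_max_orientable : orientable (eta_max H).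
Proof.
split; first by apply/forallP => v; rewrite ffunE.
have [dist hdist] := dist_to_sink.
exists (fun i => (dist (ends i).1 <= dist (ends i).2)%N) => v.
set O := (fun _ => _); rewrite ffunE -(outdeg_indeg O v lf).
rewrite -[ltnLHS]addn0 ltn_add2l indegE.
have [i [z [jz lt_z]]] := hdist v; rewrite (bigD1 i) //=.
suff -> : head_of O i = Some v by rewrite eqxx.
rewrite /head_of /O; case/orP: jz => /eqP -> /=; last by rewrite (ltnW lt_z).
by rewrite leqNgt lt_z.
Qed.

Lemma card_predS S (P : pred (edge H)) :
  #|[pred i in S | P i]| = \sum_i ((i \in S) && P i).
Proof. by rewrite -sum1_card big_mkcond; apply: eq_bigr => i _; rewrite inE; case: andb. Qed.

Lemma card_setE S : #|S| = \sum_i (i \in S).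
Proof. by rewrite -sum1_card big_mkcond; apply: eq_bigr => i _; case: (_ \in _). Qed.

(** Once the edges of [S] point to [x], another vertex gains at most one outgoing edge per grain
    received, while at most deg x - #|S| edges leave [x], which is less than the number of grains it
    keeps. *)
Lemma orientable_topple eta x S :
  unstable eta x -> S \subset edges_at x ->
  (exists O, forall v, (outdeg O v < eta v)%N) ->
  exists O, forall v, (outdeg O v < topple eta x S v)%N.
Proof.
move=> un /fintype.subsetP SS [ O hO].
pose O' i := if i \in S then (ends i).1 != Some x else O i.
have tail_S i : i \in S -> tail_of O' i = other_end i (Some x).
  by move=> iS; rewrite /tail_of /O' iS /other_end; case: eqP.
have tail_notS i : i \notin S -> tail_of O' i = tail_of O i.
  by move=> iS; rewrite /tail_of /O' (negPf iS).
exists O' => v; rewrite ffunE card_predS; have [->|vx] := eqVneq v x.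
  suff : (outdeg O' x + #|S| <= deg x)%N by move: un; rewrite /unstable; lia.
  rewrite degE card_setE -big_split leq_sum // => i _ /=.
  have [iS|iS] := boolP (i \in S); last first.
    by have := tail_or_head O' i (Some x) lf; rewrite /=; lia.
  have := SS i iS; rewrite inE => inc; rewrite tail_S // inc.
  suff /negPf -> : other_end i (Some x) != Some x by [].
  by have := lf i; rewrite /other_end; case: (eqVneq (ends i).1 (Some x)) => [->|//]; rewrite eq_sym.
rewrite subn0; apply: leq_ltn_trans (_ : (_ <= outdeg O v
    + \sum_i ((i \in S) && (other_end i (Some x) == Some v)))%N) _; last first.
  by rewrite ltn_add2r.
rewrite -big_split leq_sum // => i _ /=.
have [iS|iS] := boolP (i \in S); first by rewrite tail_S //= leq_addl.
by rewrite tail_notS //= addn0.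
Qed.

Variables (R : realType) (p : R) (D : driving H R).
Hypotheses (hp0 : (0 < p)%R) (hp1 : (p < 1)%R).

Let acc := accessible p D.

Lemma orientable_accessible eta xi : acc eta xi -> orientable eta -> orientable xi.
Proof.
move=> h [st oeta].
apply: (accessible_invariant hp0 hp1 (P := fun eta => exists O, forall v, (outdeg O v < eta v)%N)) h st oeta.
  by move=> zeta v [ O hO]; exists O => w; rewrite ffunE ltn_addr.
exact: orientable_topple.
Qed.

(** Grains are added one by one; every intermediate configuration lies below [xi], so nothing
    topples. *)
Lemma accessible_le eta xi :
  stable xi -> (forall v, eta v <= xi v)%N -> acc eta xi.
Proof.
move=> st; have [n] := ubnP (\sum_v (xi v - eta v)); elim: n eta => // n IH eta.
rewrite ltnS => le_n le_xi; have [->|/eqP ne] := eqVneq eta xi; first exact: accessible_refl.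
have [v lt_v] : exists v, (eta v < xi v)%N.
  apply: contrapT => /forallNP no; apply: ne; apply/ffunP => v.
  by apply/eqP; rewrite eqn_leq le_xi leqNgt; apply/negP/no.
have le_add w : (add_grain eta v w <= xi w)%N.
  by rewrite ffunE; case: eqP => [->|_]; rewrite ?addn1 // addn0.
apply: (@accessible_trans _ _ _ _ _ (add_grain eta v)).
  apply: (accessible_step hp0 hp1 (v := v)); apply: stabilizes_refl.
  by apply/forallP => w; apply: leq_trans (le_add w) _; exact: (forallP st).
apply: IH => //; apply: leq_trans _ le_n.
rewrite (bigD1 v) //= [ltnRHS](bigD1 v) //= -addSn leq_add //.
  by rewrite ffunE eqxx; lia.
by apply: leq_sum => w _; rewrite ffunE; lia.
Qed.

Lemma accessible_eta_max eta : stable eta -> acc eta (eta_max H).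
Proof.
move=> st; apply: accessible_le => [|v]; first by apply/forallP => v; rewrite ffunE.
by rewrite ffunE (forallP st).
Qed.

(** * Reaching an orientable configuration from the full one *)

Section Flush.
Variable dist : option (vertex H) -> nat.

(** Grains on such a set can travel to the sink without leaving it. *)
Definition downward_closed T := forall v, v \in T ->
  exists i z, [/\ joins i (Some v) z, (dist z < dist (Some v))%N & forall u, z = Some u -> u \in T].

(* The excess on [T] is driven to the sink one grain at a time, each grain
   moving closer to the sink. *)
Lemma stabilizes_flush T (zeta : config H) : downward_closed T ->
  (forall v, v \in T -> deg v <= zeta v)%N -> (forall v, v \notin T -> zeta v <= deg v)%N ->
  stabilizes p D zeta ([ffun v => if v \in T then deg v else zeta v] : config H).
Proof.
(* The measure is the sum of [dist] over all grains. Each toppling uses a single edge leading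
   strictly closer to the sink, so the measure drops. *)
move=> closedT; have [n] := ubnP (\sum_v zeta v * dist (Some v)).
elim: n zeta => // n IH zeta; rewrite ltnS => le_n geT leT.
have [st|nst] := boolP (stable zeta).
  rewrite (_ : [ffun v => _] = zeta); first exact: stabilizes_refl.
  apply/ffunP => v; rewrite ffunE; case: ifP => // vT.
  by apply/eqP; rewrite eqn_leq geT // (forallP st).
have := next_site_unstable D nst; set x := next_site D zeta; rewrite /unstable => un.
(* The toppling rule is arbitrary, but only vertices of [T] can be unstable, so its choice falls in
   [T]. *)
have xT : x \in T by apply: contraTT un => /leT; rewrite -leqNgt.
have [i [z [jz lt_z zT]]] := closedT x xT.
have toppleE v : topple zeta x [set i] v = (zeta v - (v == x) + (z == Some v))%N.
  rewrite ffunE cards1 card_predS (bigD1 i) //= big1 => [|j ji]; last first.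
    by rewrite inE (negPf ji).
  by rewrite inE eqxx (joins_other_end jz) /= addn0; case: (v == x).
apply: (stabilizes_topple hp0 hp1 (S := [set i]) nst).
  by apply/fintype.subsetP => j; rewrite !inE => /eqP ->; exact: joins_incident jz.
rewrite -/x (_ : [ffun v => _] = [ffun v => if v \in T then deg v else topple zeta x [set i] v]);
  last first.
  apply/ffunP => v; rewrite ffunE [RHS]ffunE; case: ifP => // vT.
  rewrite toppleE; have -> : (v == x) = false by apply/eqP => vx; rewrite vx xT in vT.
  by case: eqP => [/zT|_]; rewrite ?vT // subn0 addn0.
apply: IH.
- have : (\sum_v topple zeta x [set i] v * dist (Some v) + \sum_v (v == x) * dist (Some v)
     = \sum_v zeta v * dist (Some v) + \sum_v (z == Some v) * dist (Some v))%N.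
    rewrite -!big_split; apply: eq_bigr => v _ /=; rewrite toppleE -!mulnDl; congr (_ * _)%N.
    by case: eqP => [->|_]; move: un; lia.
  have -> : (\sum_v (v == x) * dist (Some v) = dist (Some x))%N.
    by rewrite (bigD1 x) //= eqxx mul1n big1 ?addn0 // => v /negPf ->.
  have : (\sum_v (z == Some v) * dist (Some v) <= dist z)%N.
    case: (z) => [u|]; last by rewrite big1.
    rewrite (bigD1 u) //= eqxx mul1n big1 ?addn0 // => v vu.
    by rewrite (inj_eq Some_inj) eq_sym (negPf vu).
  by move: le_n lt_z; lia.
- by move=> v vT; rewrite toppleE; have := geT v vT; case: eqP => [->|_]; move: un; lia.
move=> v vT; rewrite toppleE; have := leT v vT.
by case: (z =P Some v) => [/zT|_]; rewrite ?(negPf vT) //; lia.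
Qed.

(* Induction on the complement of [T].  With w nearest to the sink outside [T],
   the last steps leading to [eta] are: fill w, topple it along its in-edges,
   flush [T], and add grains at w.  The in-edges of w can then be reversed,
   since nothing is required of the orientation on [w |: T]. *)
Lemma accessible_from_eta_max T eta O :
  (forall v, exists i z, joins i (Some v) z /\ (dist z < dist (Some v))%N) ->
  downward_closed T -> stable eta ->
  (forall v, v \in T -> eta v = deg v) -> (forall v, v \notin T -> outdeg O v < eta v)%N ->
  acc (eta_max H) eta.
Proof.
move=> hdist; have [n] := ubnP #|~: T|; elim: n T eta O => // n IH T eta O.
rewrite ltnS => le_n closedT st etaT ltO.
have [T0|[w0]] := set_0Vmem (~: T).
  rewrite (_ : eta = eta_max H); first exact: accessible_refl.
  apply/ffunP => v; rewrite ffunE etaT //.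
  by rewrite -[v \in T]negbK -finset.in_setC T0 inE.
rewrite inE => w0T; case: (@arg_minnP _ w0 [pred w | w \notin T] (dist \o Some) w0T).
move=> w /= wT min_w {w0 w0T}.
pose S := [set i | head_of O i == Some w].
have SE i : i \in S -> incident i (Some w) /\ other_end i (Some w) = tail_of O i.
  rewrite inE /incident /other_end /head_of /tail_of; move: (lf i).
  by case: (ends i) => u u' /=; case: (O i) => + /eqP e; rewrite e ?eqxx ?orbT // => /negPf ->.
pose c u := #|[pred i in S | other_end i (Some w) == Some u]|.
have cw : c w = 0%N.
  rewrite /c card_predS big1 // => i _; case: (boolP (i \in S)) => //= iS.
  have [_ ->] := SE i iS; move: iS (lf i); rewrite inE /head_of /tail_of.
  by case: (O i) => /eqP ->; rewrite ?(eq_sym _ (Some w)) => /negPf -> //; rewrite eq_sym => ->.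
pose O2 i := if i \in S then ~~ O i else O i.
have out_O2 u : u != w -> (outdeg O2 u + c u <= outdeg O u)%N.
  move=> uw; rewrite /c card_predS -big_split leq_sum // => i _ /=.
  have [iS|iS] := boolP (i \in S); last by rewrite /tail_of /O2 (negPf iS) addn0.
  have [_ ->] /= := SE i iS.
  suff -> : tail_of O2 i = Some w by rewrite (inj_eq Some_inj) eq_sym (negPf uw).
  rewrite /tail_of /O2 iS; move: iS; rewrite inE /head_of.
  by case: (O i) => /eqP.
(* Outside [w |: T], the [c u] grains that [u] will receive from [w] are withheld. By [out_O2],
   reversing the in-edges of [w] lowers the out-degree of [u] at least as much. *)
pose eta2 : config H := [ffun u => if u \in w |: T then deg u else eta u - c u]%N.
have [i [z [jz lt_z]]] := hdist w.
(* By minimality of [w], its neighbour closer to the sink is the sink or lies in [T], so [w |: T] is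
   again downward closed. *)
have zT u : z = Some u -> u \in T.
  by move=> zE; apply: contraTT lt_z => /min_w; rewrite zE -leqNgt.
have le_deg v : (eta v <= deg v)%N by exact: (forallP st).
apply: (@accessible_trans _ _ _ _ _ eta2).
  apply: (IH (w |: T) _ O2).
  - apply: leq_trans le_n; apply: proper_card; rewrite finset.setCU.
    by apply/properP; split; [exact: finset.subsetIr|exists w; rewrite !inE ?eqxx].
  - move=> v; rewrite !inE => /orP[/eqP ->|/closedT[j [y [jy lt_y yT]]]].
      by exists i, z; split=> // u /zT uT; rewrite !inE uT orbT.
    by exists j, y; split=> // u /yT uT; rewrite !inE uT orbT.
  - by apply/forallP => v; rewrite ffunE; case: ifP => // _; apply: leq_trans (leq_subr _ _) _.
  - by move=> v vT; rewrite ffunE vT.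
  move=> v vT; rewrite ffunE (negPf vT); move: vT; rewrite !inE negb_or => /andP[vw vT].
  by have := ltO v vT; have := out_O2 v vw; lia.
have lt_w := ltO w wT.
have cardS : (outdeg O w + #|S| = deg w)%N.
  by rewrite -(outdeg_indeg O w lf) /indeg cardsE.
pose zeta := topple (add_grain eta2 w) w S.
have zetaE v : zeta v = (if v \in T then deg v + c v
    else if v == w then deg w + 1 - #|S| else eta v)%N.
  rewrite /zeta !ffunE -/(c v) !inE; have [->|vw] := eqVneq v w.
    by rewrite /= (negPf wT) cw addn0.
  rewrite /= addn0 subn0; case: ifP => // vT.
  by have := ltO v (negbT vT); have := out_O2 v vw; lia.
have un_w : ~~ stable (add_grain eta2 w).
  by apply/negP => /forallP/(_ w); rewrite !ffunE !inE eqxx /=; lia.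
(* Only [w] exceeds its degree, so every toppling rule must select it. *)
have site_w : next_site D (add_grain eta2 w) = w.
  have := next_site_unstable D un_w; rewrite /unstable !ffunE !inE.
  set v := next_site _ _; case: (v =P w) => //= _; case: ifP => _; have := le_deg v; lia.
(* After the flush, [w] holds deg w + 1 - #|S| grains, that is its out-degree plus one, hence at
   most [eta w]; all other vertices agree with [eta]. *)
apply: (@accessible_trans _ _ _ _ _ [ffun v => if v \in T then deg v else zeta v]); last first.
  apply: accessible_le => // v; rewrite ffunE; case: ifP => [/etaT -> //|vT].
  by rewrite zetaE vT; case: eqP => [->|]; lia.
apply: (accessible_step hp0 hp1 (v := w)).
apply: (stabilizes_topple hp0 hp1 (S := S) un_w).
  by rewrite site_w; apply/fintype.subsetP => j /SE[jw _]; rewrite inE.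
rewrite site_w; apply: stabilizes_flush => //.
  by move=> v vT; rewrite -/zeta zetaE vT leq_addr.
move=> v vT; rewrite -/zeta zetaE (negPf vT); case: eqP => // -> //.
by have := le_deg w; lia.
Qed.

End Flush.

(** Every stable configuration leads to [eta_max] by adding grains, so for a stable [eta] recurrence
    and communication both follow from access from [eta_max]. That access is the case of an empty
    [T]. *)
Lemma Sto_orientable eta : Sto p D eta <-> orientable eta.
Proof.
split=> [[st _ [h _]]|[st [ O hO]]]; first exact: orientable_accessible h eta_max_orientable.
have [dist hdist] := dist_to_sink.
have from_max : acc (eta_max H) eta.
  apply: (@accessible_from_eta_max dist finset.set0 _ O) => // v; by rewrite inE.
split=> //; last by split=> //; exact: accessible_eta_max.
move=> xi eta_xi; apply: accessible_trans from_max; apply: accessible_eta_max.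
have [] // : stable xi /\ True.
by apply: (accessible_invariant hp0 hp1 (P := fun=> True)) eta_xi st _.
Qed.

End Recurrent.

(** * Degrees and orientations under deletion and contraction *)

Section Surgery.
Variables (G : sgraph) (e : edge G) (a b : vertex G).
Hypotheses (lf : loop_free G) (he : joins e (Some a) (Some b)).
Implicit Types (eta : config G) (O : orientation G) (v : vertex G) (i : edge G).

Let Gd := delete_edge e.
Let Gc := contract_edge e a b.

Lemma joins_neq : a != b.
Proof.
have := lf e; move: he; rewrite /joins => /orP[] /eqP -> /=.
all: by rewrite (inj_eq Some_inj) // eq_sym.
Qed.

(** Deletion and contraction share one edge type, so this identity compares the edge counts of both
    with those of [G]. *)
Lemma sum_neq_edge (F : edge G -> nat) :
  (\sum_(j : {i : edge G | i != e}) F (val j) + F e = \sum_i F i)%N.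
Proof.
rewrite [RHS](bigD1 e) //= addnC; congr (_ + _)%N.
by rewrite (big_sub (fun i => i != e)).
Qed.

Lemma multiplicityE : multiplicity (Some a) (Some b) = \sum_i joins i (Some a) (Some b).
Proof.
by rewrite /multiplicity -sum1_card big_mkcond; apply: eq_bigr => i _; rewrite inE; case: joins.
Qed.

Lemma orient_along i y z : joins i y z ->
  exists w, forall O, O i = w -> tail_of O i = y /\ head_of O i = z.
Proof.
by rewrite /joins /tail_of /head_of => /orP[] /eqP ->; [exists true|exists false] => O ->.
Qed.

Lemma tail_head_joins O i y z : joins i y z ->
  (tail_of O i = y /\ head_of O i = z) \/ (tail_of O i = z /\ head_of O i = y).
Proof.
by rewrite /joins /tail_of /head_of => /orP[] /eqP -> /=; case: (O i); [left|right|right|left].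
Qed.

Lemma extend_orientation (O' : {i : edge G | i != e} -> bool) (w : bool) :
  exists2 O, (forall j, O (val j) = O' j) & O e = w.
Proof.
exists (fun i => if insub i is Some j then O' j else w) => [j|]; first by rewrite valK.
by rewrite insubF ?eqxx.
Qed.

Lemma incident_e v : incident e (Some v) = (v == a) || (v == b).
Proof.
move: he; rewrite /joins /incident => /orP[] /eqP -> /=; rewrite !(inj_eq Some_inj) //.
by rewrite orbC.
Qed.

Lemma deg_delete v : (deg (v : vertex Gd) + (v == a) + (v == b) = deg v)%N.
Proof.
rewrite !degE -(sum_neq_edge (fun i => incident i (Some v) : nat)) incident_e -addnA.
congr (_ + _)%N; have := joins_neq.
by case: (v =P a) => [-> /negPf -> //|_ _]; case: (v == b).
Qed.

Definition restrict_delete O : orientation Gd := fun j => O (val j).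

Lemma outdeg_delete O v :
  (outdeg (restrict_delete O) v + (tail_of O e == Some v) = outdeg O v)%N.
Proof. exact: (sum_neq_edge (fun i => (tail_of O i == Some v) : nat)). Qed.

Lemma delete_loop_free : loop_free Gd.
Proof. by move=> j; exact: lf. Qed.

Lemma contract_proj_some y (v : {v : vertex G | (v != a) && (v != b)}) :
  (contract_proj a b y == Some (Some v)) = (y == Some (val v)).
Proof.
case: y => [u|] //=; rewrite !(inj_eq Some_inj); case: insubP => [u' hu <-|hu].
  by rewrite (inj_eq Some_inj).
by apply/esym/eqP => uv; move: hu; rewrite uv (valP v).
Qed.

Lemma contract_proj_merged y :
  (contract_proj a b y == Some None) = (y == Some a) || (y == Some b).
Proof.
case: y => [u|] //=; rewrite !(inj_eq Some_inj); case: insubP => [u' hu _|hu].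
  by move: hu; case: eqP => //=; case: eqP.
by rewrite eqxx; move: hu; rewrite negb_and !negbK => ->.
Qed.

Lemma contract_proj_none y : (contract_proj a b y == None) = (y == None).
Proof. by case: y. Qed.

(** Distinct ends with the same projection must be [a] and [b], and the edges joining these are
    redirected to the sink. *)
Lemma contract_loop_free : loop_free Gc.
Proof.
move=> j; rewrite /= /contract_ends; case: ifP => // nj.
set y := (ends (val j)).1; set z := (ends (val j)).2.
have yz : y != z := lf (val j).
apply/negP => /eqP; case E : (contract_proj a b y) => [[v|]|] /esym/eqP.
- move/eqP: E; rewrite !contract_proj_some => /eqP y1 /eqP z1.
  by rewrite y1 z1 eqxx in yz.
- move/eqP: E; rewrite !contract_proj_merged => y1 z1.
  move: nj; rewrite /joins [ends _]surjective_pairing -/y -/z !xpair_eqE; move: yz.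
  case/orP: y1 => /eqP ->; case/orP: z1 => /eqP ->; rewrite ?eqxx ?orbT //.
move/eqP: E; rewrite !contract_proj_none => /eqP y1 /eqP z1.
by rewrite y1 z1 eqxx in yz.
Qed.

(** Paths of [G] project: a step between [a] and [b] becomes stationary, and any other step follows
    an edge of the contraction. *)
Lemma contract_connected : graph_connected G -> graph_connected Gc.
Proof.
move=> conn.
have proj_connect y z : connect (@Defs.adjacent Gc) (contract_proj a b y) (contract_proj a b z).
  have /connectP[s + ->] := conn y z; elim: s y => [|x s IH] y /=; first by rewrite connect0.
  case/andP=> /existsP[i ji] /IH; apply: connect_trans.
  have [jab|nj] := boolP (joins i (Some a) (Some b)).
    suff -> : contract_proj a b y = contract_proj a b x by exact: connect0.
    have pa : contract_proj a b (Some a) = Some None.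
      by apply/eqP; rewrite contract_proj_merged eqxx.
    have pb : contract_proj a b (Some b) = Some None.
      by apply/eqP; rewrite contract_proj_merged eqxx orbT.
    move: ji jab; rewrite /joins => /orP[] /eqP -> /orP[] /eqP[-> ->];
      by rewrite pa pb.
  have ie : i != e by apply: contraNneq nj => ->.
  apply: connect1; apply/existsP; exists (Sub i ie : edge Gc).
  rewrite /joins /= /contract_ends SubK (negPf nj).
  by move: ji; rewrite /joins => /orP[] /eqP -> /=; rewrite eqxx ?orbT.
have proj_surj (y : option (vertex Gc)) : exists z, contract_proj a b z = y.
  case: y => [[v|]|]; last by exists None.
    by exists (Some (val v)); apply/eqP; rewrite contract_proj_some.
  by exists (Some a); apply/eqP; rewrite contract_proj_merged eqxx.
by move=> y z; have [u <-] := proj_surj y; have [w <-] := proj_surj z.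
Qed.

Lemma deg_contract (v : {v : vertex G | (v != a) && (v != b)}) :
  deg (Some v : vertex Gc) = deg (val v).
Proof.
have /andP[va vb] := valP v.
rewrite !degE -(sum_neq_edge (fun i => incident i (Some (val v)) : nat)) incident_e.
rewrite (negPf va) (negPf vb) addn0; apply: eq_bigr => j _; congr nat_of_bool.
rewrite /incident /= /contract_ends; case: ifP => [|_] /=.
  rewrite /joins => /orP[] /eqP -> /=; rewrite !(inj_eq Some_inj) ?(negPf va) ?(negPf vb) //.
by rewrite !(eq_sym (Some _)) !contract_proj_some.
Qed.

(** The k parallel edges contribute 2k to the right-hand side but only k - 1 to the merged vertex,
    as edges to the sink; the difference is k + 1. *)
Lemma deg_merged :
  (deg (merged e a b) + (multiplicity (Some a) (Some b)).+1 = deg a + deg b)%N.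
Proof.
rewrite !degE multiplicityE.
rewrite -(sum_neq_edge (fun i => incident i (Some a) : nat)).
rewrite -(sum_neq_edge (fun i => incident i (Some b) : nat)).
rewrite -(sum_neq_edge (fun i => joins i (Some a) (Some b) : nat)).
rewrite !incident_e he !eqxx orbT -(addn1 (_ + _)) -addnA /= addnACA addnA; congr (_ + _)%N.
rewrite -!big_split; apply: eq_bigr => j _ /=.
have := lf (val j); rewrite /incident /= /contract_ends; case: ifP => [|].
  by rewrite /joins => /orP[] /eqP -> /= _; rewrite !eqxx !orbT.
rewrite /= !(eq_sym (Some _)) !contract_proj_merged /joins.
case: (ends (val j)) => y z /=; rewrite !xpair_eqE.
have := joins_neq; rewrite -(inj_eq (@Some_inj _)) => /eqP ab + /eqP yz.
by case: (y =P Some a) => ?; case: (y =P Some b) => ?;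
  case: (z =P Some a) => ?; case: (z =P Some b) => ? //; congruence.
Qed.

(* Edges parallel to [e] become edges to the sink, oriented out of it so that
   they do not count at the merged vertex. *)
Definition restrict_contract O : orientation Gc :=
  fun j => if joins (val j) (Some a) (Some b) then false else O (val j).

Lemma tail_contract O (j : edge Gc) : tail_of (restrict_contract O) j =
  if joins (val j) (Some a) (Some b) then None else contract_proj a b (tail_of O (val j)).
Proof.
case: j => i ie; rewrite /tail_of /restrict_contract /= /contract_ends /=.
by case: (joins _ _ _) => //; case: (O i).
Qed.

Lemma outdeg_contract O (v : {v : vertex G | (v != a) && (v != b)}) :
  outdeg (restrict_contract O) (Some v) = outdeg O (val v).
Proof.
have /andP[va vb] := valP v.
have tail_ab i : joins i (Some a) (Some b) -> (tail_of O i == Some (val v)) = false.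
  by move=> /(tail_head_joins O)[] [-> _];
    rewrite (inj_eq Some_inj) eq_sym ?(negPf va) ?(negPf vb).
rewrite /outdeg -(sum_neq_edge (fun i => (tail_of O i == Some (val v)) : nat)) tail_ab // addn0.
apply: eq_bigr => j _; rewrite tail_contract; case: ifP => [/tail_ab -> //|_].
by rewrite contract_proj_some.
Qed.

(** Each parallel edge leaves exactly one of [a] and [b], and after restriction none of them leaves
    the merged vertex. *)
Lemma outdeg_merged O :
  (outdeg (restrict_contract O) (merged e a b) + multiplicity (Some a) (Some b)
     = outdeg O a + outdeg O b)%N.
Proof.
have ab : (Some a == Some b :> option _) = false by rewrite (inj_eq Some_inj) (negPf joins_neq).
have tail_ab i : joins i (Some a) (Some b) ->
    ((tail_of O i == Some a) + (tail_of O i == Some b) = 1)%N.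
  by move=> /(tail_head_joins O)[] [-> _]; rewrite eqxx ?ab // eq_sym ab.
rewrite /outdeg multiplicityE.
rewrite -(sum_neq_edge (fun i => (tail_of O i == Some a) : nat)).
rewrite -(sum_neq_edge (fun i => (tail_of O i == Some b) : nat)).
rewrite -(sum_neq_edge (fun i => joins i (Some a) (Some b) : nat)).
rewrite addnACA tail_ab // he addnA; congr (_ + _)%N.
rewrite -!big_split; apply: eq_bigr => j _ /=; rewrite tail_contract.
case: ifP => [/tail_ab -> //|_]; rewrite contract_proj_merged addn0.
by case: (tail_of O _ =P Some a) => [->|]; rewrite ?ab.
Qed.

(** The out-degrees may drop at the merged vertex: [O'] may orient a former parallel edge towards
    the sink, while restriction always orients it out of the sink. *)
Lemma lift_contract_orientation (O' : orientation Gc) : exists O,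
  tail_of O e = Some a /\ forall w, (outdeg (restrict_contract O) w <= outdeg O' w)%N.
Proof.
have [w hw] := orient_along he.
have [ O hO Oe] := extend_orientation O' w.
exists O; split; first by have [] := hw O Oe.
move=> u; rewrite leq_sum // => j _; rewrite tail_contract; case: ifP => // nj.
by rewrite /tail_of hO /= /contract_ends nj /=; case: (O' j).
Qed.

End Surgery.

Arguments restrict_delete [G] e O.
Arguments restrict_contract [G] e a b O.
Arguments outdeg_delete [G] e O v.

(** * The two halves of the bijection, on orientable configurations *)

Section Bijection.
Variables (G : sgraph) (e : edge G) (a b : vertex G).
Hypotheses (lf : loop_free G) (he : joins e (Some a) (Some b)).
Implicit Types (eta : config G) (O : orientation G) (v : vertex G) (i : edge G).

Let ab : a != b := joins_neq lf he.
Let k := multiplicity (Some a) (Some b).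

(* The set A of the paper; by symmetry between parallel edges, the edge
   oriented from a to b may be taken to be [e]. *)
Definition orientableA eta : Prop :=
  [/\ stable eta, (eta b < deg b)%N
    & exists O, (forall v, (outdeg O v < eta v)%N) /\ tail_of O e = Some a].

Lemma head_of_opposite O : tail_of O e = Some a -> head_of O e = Some b.
Proof.
case: (tail_head_joins O he) => -[] // -> _ [abE].
by move: ab; rewrite abE eqxx.
Qed.

(** If [e] points from [b] to [a], it forms a directed 2-cycle with [i]; reversing both changes no
    out-degree. *)
Lemma orient_from_a eta O i : (forall v, (outdeg O v < eta v)%N) ->
  tail_of O i = Some a -> head_of O i = Some b ->
  exists O', (forall v, (outdeg O' v < eta v)%N) /\ tail_of O' e = Some a.
Proof.
move=> hO ti hi; case: (tail_head_joins O he) => -[te h_e]; first by exists O.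
have ei : e != i.
  by apply: contraNneq ab => e_i; move: te; rewrite e_i ti => -[->].
exists (flip (flip O i) e); split=> [v|]; last first.
  by rewrite tail_flip /head_of /flip (negPf ei) -/(head_of O e).
have := outdeg_flip (flip O i) e v; have := outdeg_flip O i v.
rewrite tail_flip_neq // ti hi te.
have -> : head_of (flip O i) e = head_of O e by rewrite /head_of /flip (negPf ei).
by rewrite h_e; have := hO v; lia.
Qed.

(** Removing [e] together with a grain at [a] lowers out-degree and grains at [a] alike; [b] stays
    stable because it was below its degree. *)
Lemma orientableA_delete eta : orientableA eta ->
  orientable (sto_mapA e a eta) /\ (0 < eta a)%N.
Proof.
move=> [st ltb [ O [hO te]]].
have ta v : (tail_of O e == Some v) = (v == a) by rewrite te (inj_eq Some_inj) eq_sym.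
split; last by have := hO a; lia.
split.
  apply/forallP => v; rewrite ffunE; have := deg_delete lf he v.
  have := forallP st v; have := hO v; have := outdeg_delete e O v; rewrite ta.
  by case: (v =P b) ltb => [->|_]; lia.
exists (restrict_delete e O) => v; rewrite ffunE.
by have := hO v; have := outdeg_delete e O v; rewrite ta; lia.
Qed.

Lemma delete_orientableA eta : (0 < eta a)%N ->
  orientable (sto_mapA e a eta) -> orientableA eta.
Proof.
move=> a_gt0 [st [ O' hO']].
have [w hw] := orient_along he; have [ O hO Oe] := extend_orientation O' w.
have [te _] := hw O Oe.
have deg_v v : (eta v + (v == b) <= deg v)%N.
  have := forallP st v; rewrite ffunE; have := deg_delete lf he v.
  by case: (v =P a) a_gt0 => [->|_]; lia.
split; first by apply/forallP => v; have := deg_v v; lia.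
  by have := deg_v b; rewrite eqxx addn1.
exists O; split=> // v; have := hO' v; have := outdeg_delete e O v.
rewrite te (inj_eq Some_inj) (eq_sym a) ffunE.
suff -> : outdeg (restrict_delete e O) v = outdeg O' v.
  by case: (v =P a) a_gt0 => [->|_]; lia.
by apply: eq_bigr => j _; rewrite /tail_of /restrict_delete hO.
Qed.

(** All k parallel edges leave [a] or [b], and both vertices exceed their out-degree. Hence the
    truncated subtraction in [sto_mapB] is exact. *)
Lemma merged_ge eta O : (forall v, (outdeg O v < eta v)%N) -> (k.+1 < eta a + eta b)%N.
Proof. by move=> hO; have := hO a; have := hO b; have := outdeg_merged lf he O; rewrite -/k; lia. Qed.

(** The strict inequalities at [a] and [b] give a surplus of two; losing k + 1 grains against k
    outgoing edges leaves a surplus of one. *)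
Lemma orientable_contract eta : orientable eta -> orientable (sto_mapB e a b eta).
Proof.
move=> [st [ O hO]]; split.
  apply/forallP => -[v|]; rewrite ffunE; first by rewrite (deg_contract he) (forallP st).
  have := deg_merged lf he; rewrite /merged -/k.
  by have := forallP st a; have := forallP st b; lia.
exists (restrict_contract e a b O) => -[v|]; rewrite ffunE.
  by rewrite (outdeg_contract he).
have := merged_ge hO; have := outdeg_merged lf he O; rewrite /merged -/k.
by have := hO a; have := hO b; lia.
Qed.

(* If the fibre of the contraction map contains a configuration with more
   grains at b, then no set containing a but not b is tight for [eta], so Hall's
   condition survives the removal of [e] and of a grain at a. *)
Lemma orientableA_of_fibre eta eta' : orientable eta -> orientable eta' ->
  (forall v, v != a -> v != b -> eta v = eta' v) ->
  (eta a + eta b = eta' a + eta' b)%N -> (eta b < eta' b)%N -> orientableA eta.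
Proof.
move=> [st [ O hO]] [st' [ O' hO']] eqv eqab ltb.
have lta : (1 < eta a)%N by have := hO' a; lia.
apply: delete_orientableA; first lia.
split.
  apply/forallP => v; rewrite ffunE; have := deg_delete lf he v; have := forallP st v.
  have := forallP st' b; case: (v =P a) lta => [->|_]; first by rewrite (negPf ab); lia.
  by case: (v =P b) ltb => [->|_]; lia.
pose c v := ((eta v).-1 - (v == a))%N.
suff hall (A : {set vertex G}) :
    (\sum_(j : {i : edge G | i != e}) inner_edge A (val j) <= \sum_(v in A) c v)%N.
  have [A|O1 hO1] := @hall_orientation (delete_edge e) c finset.setT.
    by apply: leq_trans (hall A); rewrite leq_eqVlt (eq_bigl predT) ?eqxx // => j; rewrite inE.
  exists O1 => v; rewrite ffunE; have := hO1 v; rewrite /c.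
  have -> : \sum_(j in finset.setT) (tail_of O1 j == Some v) = outdeg O1 v.
    by apply: eq_bigl => j; rewrite inE.
  by have := hO v; case: (v =P a) lta => [->|_]; lia.
have := sum_neq_edge e (fun i => inner_edge A i : nat) => /=.
have in_e : inner_edge A e = (a \in A) && (b \in A).
  by move: he; rewrite /inner_edge /joins => /orP[] /eqP -> //=; rewrite andbC.
have := inner_edge_outdeg O A; have := inner_edge_outdeg O' A; rewrite in_e.
(* If [a] is not in [A], the bound given by [O] is enough. If [a] and [b] both are, the removed edge
   [e] was inner, which pays for the grain taken at [a]. *)
have [aA|aA] /= := boolP (a \in A); last first.
  have : (\sum_(v in A) outdeg O v <= \sum_(v in A) c v)%N.
    apply: leq_sum => v vA; rewrite /c; have := hO v.
    by case: (v =P a) => [va|_]; [rewrite -va vA in aA | lia].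
  lia.
have [bA|bA] /= := boolP (b \in A).
  have : (\sum_(v in A) outdeg O v <= \sum_(v in A) (eta v).-1)%N.
    by apply: leq_sum => v _; have := hO v; lia.
  have : (\sum_(v in A) c v + \sum_(v in A) (v == a) = \sum_(v in A) (eta v).-1)%N.
    rewrite -big_split; apply: eq_bigr => v _; rewrite /c /=.
    by case: (v =P a) lta => [->|_]; lia.
  have -> : \sum_(v in A) (v == a) = 1%N.
    by rewrite (bigD1 a) //= eqxx big1 // => v /andP[_ /negPf ->].
  lia.
(* With [a] but not [b] in [A], the orientation [O'] is used: [eta' a] is smaller than [eta a],
   which pays for the grain, and the two configurations agree on the rest of [A]. *)
have : (\sum_(v in A) outdeg O' v <= \sum_(v in A) c v)%N.
  apply: leq_sum => v vA; rewrite /c; have := hO' v.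
  have vb : v != b by apply: contraNneq bA => <-.
  by have [->|va] := eqVneq v a; [lia | rewrite (eqv v va vb); lia].
lia.
Qed.

(** Equal images leave only the split between [a] and [b] free; of two different splits, the one
    with fewer grains at [b] would satisfy [orientableA]. *)
Lemma sto_mapB_inj eta eta' : orientable eta -> orientable eta' ->
  ~ orientableA eta -> ~ orientableA eta' ->
  sto_mapB e a b eta = sto_mapB e a b eta' -> eta = eta'.
Proof.
move=> oeta oeta' nA nA' /ffunP eqB.
have eqv v : v != a -> v != b -> eta v = eta' v.
  move=> va vb; have vab : (v != a) && (v != b) by rewrite va.
  by have := eqB (Some (Sub v vab)); rewrite !ffunE.
have eqab : (eta a + eta b = eta' a + eta' b)%N.
  have := eqB None; rewrite !ffunE -/k.
  by have [_ [ O /merged_ge]] := oeta; have [_ [ O' /merged_ge]] := oeta'; lia.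
have eqb : eta b = eta' b.
  case: (ltngtP (eta b) (eta' b)) => // ltb; exfalso.
    exact/nA/(orientableA_of_fibre oeta oeta').
  by apply/nA'/(orientableA_of_fibre oeta' oeta) => // v va vb; rewrite eqv.
apply/ffunP => v; have [->|va] := eqVneq v a; first lia.
by have [->|vb] := eqVneq v b; last exact: eqv.
Qed.

(** For sharing the grains of the merged vertex: each share must exceed an out-degree and not exceed
    a degree. The witness is the least admissible first share. *)
Lemma box_exists (x y s dx dy : nat) : (x < dx -> y < dy -> x + y + 2 <= s -> s <= dx + dy ->
  exists m n, [/\ m + n = s, x < m <= dx & y < n <= dy])%N.
Proof.
by move=> *; exists (maxn x.+1 (s - dy)), (s - maxn x.+1 (s - dy))%N; split; lia.
Qed.

Lemma orientable_lift (xi : config (contract_edge e a b)) : orientable xi ->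
  exists2 eta, orientable eta & sto_mapB e a b eta = xi.
Proof.
move=> [st [ O' hO']]; have [ O [te leO]] := lift_contract_orientation he O'.
have degab := deg_merged lf he; rewrite -/k in degab.
have le_m := forallP st (merged e a b).
pose s := (xi (merged e a b) + k.+1)%N.
have les : (s <= deg a + deg b)%N by rewrite /s; lia.
have ges : (outdeg O a + outdeg O b + 2 <= s)%N.
  have := outdeg_merged lf he O; rewrite -/k /s.
  by have := leO (merged e a b); have := hO' (merged e a b); lia.
have he_head := head_of_opposite te.
have outb : (outdeg O b < deg b)%N.
  rewrite -(outdeg_indeg O b lf) -[ltnLHS]addn0 ltn_add2l indegE (bigD1 e) //=.
  by rewrite he_head eqxx.
have outa : (outdeg O a <= deg a)%N by rewrite -(outdeg_indeg O a lf) leq_addr.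
have [ O1 [out1 [out1a out1b out1s]]] : exists O1,
    (forall v, v != a -> v != b -> outdeg O1 v = outdeg O v) /\
    [/\ (outdeg O1 a < deg a)%N, (outdeg O1 b < deg b)%N
      & (outdeg O1 a + outdeg O1 b = outdeg O a + outdeg O b)%N].
  (* If every edge at [a] leaves it, no stable share exists there and [e] is reversed; [ges] and
     [les] then leave [b] room for one more outgoing edge. *)
  case: (ltnP (outdeg O a) (deg a)) => [lta|gea]; first by exists O.
  have out_flip v : (outdeg (flip O e) v + (v == a) = outdeg O v + (v == b))%N.
    by have := outdeg_flip O e v; rewrite te he_head !(inj_eq Some_inj) !(eq_sym _ v).
  exists (flip O e); split=> [v /negPf va /negPf vb|].
    by have := out_flip v; rewrite va vb !addn0.
  have := out_flip a; have := out_flip b.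
  by rewrite !eqxx (negPf ab) eq_sym (negPf ab); split; lia.
have [|m [n [smn /andP[m1 m2] /andP[n1 n2]]]] := box_exists out1a out1b _ les.
  by rewrite out1s.
(* The default 0 is never taken: [insub] fails only at [a] and [b]. *)
pose eta : config G := [ffun v => if v == a then m else if v == b then n
  else if insub v is Some w then xi (Some w) else 0%N].
have eta_a : eta a = m by rewrite ffunE eqxx.
have eta_b : eta b = n by rewrite ffunE eqxx eq_sym (negPf ab).
have etaE (w : {v : vertex G | (v != a) && (v != b)}) : eta (val w) = xi (Some w).
  by have /andP[/negPf wa /negPf wb] := valP w; rewrite ffunE wa wb valK.
have vP (P : vertex G -> Prop) : P a -> P b ->
    (forall w : {v : vertex G | (v != a) && (v != b)}, P (val w)) -> forall v, P v.
  move=> Pa Pb Pw v; have [->//|va] := eqVneq v a; have [->//|vb] := eqVneq v b.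
  have vab : (v != a) && (v != b) by rewrite va.
  exact: (Pw (Sub v vab)).
exists eta.
  split; first apply/forallP.
    by apply: vP; rewrite ?eta_a ?eta_b // => w; rewrite etaE -(deg_contract he) (forallP st).
  exists O1; apply: vP; rewrite ?eta_a ?eta_b // => w.
  have /andP[wa wb] := valP w.
  rewrite etaE out1 // -(outdeg_contract he).
  exact: leq_ltn_trans (leO _) (hO' _).
apply/ffunP => -[w|]; rewrite ffunE ?etaE // eta_a eta_b -/k smn /s.
exact: addnK.
Qed.

(* Among the preimages, one with the most grains at b is not in A: otherwise
   reversing [e] would allow moving one more grain from a to b. *)
Lemma sto_mapB_surj (xi : config (contract_edge e a b)) : orientable xi ->
  exists eta, [/\ orientable eta, ~ orientableA eta & sto_mapB e a b eta = xi].
Proof.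
move=> oxi.
pose P n := `[< exists eta, [/\ orientable eta, sto_mapB e a b eta = xi & eta b = n] >].
have exP : exists n, P n.
  have [eta oeta etaB] := orientable_lift oxi.
  by exists (eta b); apply/asboolP; exists eta.
have leP n : P n -> (n <= deg b)%N.
  by move=> /asboolP[eta [[st _] _ <-]]; exact: (forallP st).
case: (ex_maxnP exP leP) => n /asboolP[eta [oeta etaB eta_b]] maxn.
exists eta; split=> // -[st ltb [ O [hO te]]].
pose eta' : config G := [ffun v => (eta v - (v == a) + (v == b))%N].
have he_head := head_of_opposite te.
have a_gt0 : (0 < eta a)%N by have := hO a; lia.
suff : P n.+1 by move=> /maxn; rewrite ltnn.
apply/asboolP; exists eta'; split; last first.
- by rewrite ffunE eq_sym (negPf ab) eqxx eta_b subn0 addn1.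
- rewrite -etaB; apply/ffunP => -[[v /= vab]|]; rewrite [LHS]ffunE [RHS]ffunE /= ?ffunE /=.
    by have /andP[/negPf -> /negPf ->] := vab; rewrite subn0 addn0.
  by rewrite !eqxx (negPf ab) eq_sym (negPf ab); lia.
split.
  apply/forallP => v; rewrite ffunE; have := forallP st v.
  by case: (v =P b) ltb => [->|_]; lia.
exists (flip O e) => v; rewrite ffunE; have := hO v.
have := outdeg_flip O e v; rewrite te he_head !(inj_eq Some_inj) !(eq_sym _ v).
by case: (v =P a) a_gt0 => [->|_]; lia.
Qed.

End Bijection.

(** * Back to the sandpile chain: assembling the bijection *)

Lemma StoA_orientableA (R : realType) (p : R) (G : sgraph) (D : driving G R)
    (e : edge G) (a b : vertex G) (eta : config G) :
  (0 < p)%R -> (p < 1)%R -> loop_free G -> graph_connected G -> joins e (Some a) (Some b) ->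
  StoA p D a b eta <-> orientableA e a b eta.
Proof.
move=> p0 p1 lf conn he; split=> [[oeta ltb [ O [/(compatibleE _ _ lf) hO [i [ti hi]]]]]|].
  split; last exact: (orient_from_a lf he hO ti hi).
    by have [] := (Sto_orientable lf conn D p0 p1 eta).1 oeta.
  by move: ltb; rewrite /lack; lia.
move=> [st ltb [ O [hO te]]]; split.
- by apply/(Sto_orientable lf conn D p0 p1); split=> //; exists O.
- by rewrite /lack; lia.
exists O; split; first exact/compatibleE.
by exists e; rewrite (head_of_opposite lf he te).
Qed.

Local Open Scope classical_set_scope.
Local Open Scope ring_scope.

Theorem theorem4p3 (R : realType) (p : R) (hp0 : 0 < p) (hp1 : p < 1)
    (G : sgraph) (hloop : loop_free G) (hconn : graph_connected G)
    (e : edge G) (a b : vertex G) (he : joins e (Some a) (Some b))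
    (hbridge : ~ bridge e)
    (DG : driving G R) (Ddel : driving (delete_edge e) R)
    (Dcon : driving (contract_edge e a b) R) :
  [/\ forall eta : config G, StoA p DG a b eta ->
        [/\ sto_map e a b p DG eta = inl (sto_mapA e a eta),
            lack (sto_mapA e a eta) a = lack eta a,
            lack (sto_mapA e a eta) b = lack eta b - 1
          & forall v : vertex G, v != a -> v != b ->
              lack (sto_mapA e a eta) v = lack eta v],
      forall eta : config G, StoB p DG a b eta ->
        [/\ sto_map e a b p DG eta = inr (sto_mapB e a b eta),
            lack (sto_mapB e a b eta) (merged e a b) = lack eta a + lack eta b
          & forall v : {v : vertex G | (v != a) && (v != b)},
              sto_mapB e a b eta (Some v) = eta (val v)]
    & set_bij (Sto p DG)
        (inl @` Sto p Ddel `|` inr @` Sto p Dcon)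
        (sto_map e a b p DG : config G -> config (delete_edge e) + config (contract_edge e a b))].
Proof.
have conn_del : graph_connected (delete_edge e) by apply: contrapT.
have StoE eta := Sto_orientable hloop hconn DG hp0 hp1 eta.
have StoAE eta := StoA_orientableA DG eta hp0 hp1 hloop hconn he.
have StoE_del eta := Sto_orientable (@delete_loop_free _ e hloop) conn_del Ddel hp0 hp1 eta.
have StoE_con eta :=
  Sto_orientable (contract_loop_free hloop) (contract_connected he hconn) Dcon hp0 hp1 eta.
have ab := joins_neq hloop he.
have mapA eta : StoA p DG a b eta -> sto_map e a b p DG eta = inl (sto_mapA e a eta).
  by move=> hA; rewrite /sto_map asboolT.
have mapB eta : ~ StoA p DG a b eta -> sto_map e a b p DG eta = inr (sto_mapB e a b eta).
  by move=> hA; rewrite /sto_map asboolF.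
split.
- move=> eta hA; have [_ a_gt0] := orientableA_delete hloop he ((StoAE eta).1 hA).
  have deg_v v := deg_delete hloop he v.
  split; first exact: mapA.
  + by have := deg_v a; rewrite /lack ffunE eqxx (negPf ab); lia.
  + by have := deg_v b; rewrite /lack ffunE eqxx eq_sym (negPf ab); lia.
  move=> v va vb; have := deg_v v; rewrite /lack ffunE (negPf va) (negPf vb); lia.
- move=> eta [/StoE[_ [ O hO]] hB]; split; first exact: mapB.
    have := deg_merged hloop he; have := merged_ge hloop he hO.
    by rewrite /lack /merged ffunE; lia.
  by move=> v; rewrite ffunE.
split.
- move=> eta oeta; have [hA|hB] := pselect (StoA p DG a b eta).
    rewrite mapA //; left; exists (sto_mapA e a eta) => //; apply/StoE_del.
    by have [] := orientableA_delete hloop he ((StoAE eta).1 hA).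
  rewrite mapB //; right; exists (sto_mapB e a b eta) => //; apply/StoE_con.
  apply: (orientable_contract hloop he); exact/StoE.
- move=> eta eta' /set_mem/StoE oeta /set_mem/StoE oeta'.
  have [hA|hB] := pselect (StoA p DG a b eta); have [hA'|hB'] := pselect (StoA p DG a b eta').
  + rewrite !mapA // => -[/ffunP eqA].
    have [_ a_gt0] := orientableA_delete hloop he ((StoAE eta).1 hA).
    have [_ a_gt0'] := orientableA_delete hloop he ((StoAE eta').1 hA').
    (* Both configurations have a grain at [a], so the truncated subtraction loses no information
       there. *)
    apply/ffunP => v; have := eqA v; rewrite !ffunE.
    by case: eqP => [->|_]; lia.
  + by rewrite mapA // mapB.
  + by rewrite mapB // mapA.
  rewrite !mapB // => -[]; apply: (sto_mapB_inj hloop he) => //.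
    by move=> /StoAE.
  by move=> /StoAE.
- move=> _ [[xi /StoE_del oxi <-]|[xi /StoE_con oxi <-]].
  (* The deletion has the same vertices as [G], so the grain removed by [sto_mapA] can simply be put
     back. *)
  pose eta := add_grain (xi : config G) a.
  have etaA : sto_mapA e a eta = xi by apply/ffunP => v; rewrite !ffunE addnK.
  have hA : StoA p DG a b eta.
    apply/StoAE; apply: delete_orientableA => //; first by rewrite ffunE eqxx addn1.
    by rewrite etaA.
  by exists eta; [case: hA | rewrite mapA // etaA].
have [eta [oeta nA etaB]] := sto_mapB_surj hloop he oxi.
exists eta; first exact/StoE.
by rewrite mapB ?etaB // => /StoAE.
Qed.
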